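(* Let $N\ge1$, let $\lambda=(\lambda_1,\dots,\lambda_N)$ be a partition (zero entries allowed), and let $x^{\pm}=(x_1^{\pm1},\dots,x_N^{\pm1})$. Then $$sp_\lambda(x^{\pm})=\sum_{\mu\prec\lambda}(-1)^{|\lambda/\mu|}so_\mu(x^{\pm}),\qquad so_\lambda(x^{\pm})=\sum_{\mu\prec\lambda}o_\mu(x^{\pm}),$$ where the sums are over all $\mu=(\mu_1,\dots,\mu_N)$ of nonnegative integers with $\lambda_{i+1}\le\mu_i\le\lambda_i$ for $1\le i\le N$ (with $\lambda_{N+1}=0$), and $|\lambda/\mu|=|\lambda|-|\mu|$.
   Context: In the $N$ variables $x_1,\dots,x_N$, let $h_n=h_n(x^{\pm})$ be defined by $\prod_{i=1}^N\frac{1}{(1-x_iz)(1-x_i^{-1}z)}=\sum_{n}h_nz^n$ ($h_n=0$ for $n<0$). For a partition $\lambda=(\lambda_1,\dots,\lambda_N)$ (zeros allowed), the odd orthogonal, symplectic and (even) orthogonal characters of the classical groups are given by their Jacobi–Trudi determinants ($1\le i,j\le N$): $so_\lambda(x^{\pm})=\det(h_{\lambda_i-i+j}+h_{\lambda_i-i-j+1})$, $sp_\lambda(x^{\pm})=\det(h_{\lambda_i-i+j}+\delta_{j>1}h_{\lambda_i-i-j+2})$, $o_\lambda(x^{\pm})=\det(h_{\lambda_i-i+j}-h_{\lambda_i-i-j})$, where $\delta_{j>1}$ is $1$ if $j>1$ and $0$ otherwise. *)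

(* Defs.v *)
From HB Require Import structures.
From mathcomp Require Import all_boot all_order all_algebra.

Set Implicit Arguments.
Unset Strict Implicit.
Unset Printing Implicit Defensive.

Import GRing.Theory.
Local Open Scope ring_scope.

(* A formal power series in z is its sequence of coefficients. *)
Section PowerSeries.
Variable R : comUnitRingType.
Implicit Types (f g : nat -> R) (a : R) (p q : {poly R}).

Definition ps_one : nat -> R := fun n => (n == 0%N)%:R.

Definition ps_mul f g : nat -> R :=
  fun n => \sum_(k < n.+1) f k * g (n - k)%N.

(* 1 / (1 - a z) *)
Definition ps_geom a : nat -> R := fun n => a ^+ n.

(* prod_i 1 / ((1 - x_i z) (1 - x_i^-1 z)) *)
Definition gen_series N (x : 'I_N -> R) : nat -> R :=
  \big[ps_mul/ps_one]_(i < N) ps_mul (ps_geom (x i)) (ps_geom (x i)^-1).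

Definition h N (x : 'I_N -> R) (n : int) : R :=
  match n with Posz m => gen_series x m | Negz _ => 0 end.

Let eqmod m f p := forall n, (n < m)%N -> f n = p`_n.

Let eqmod_mul m f g p q :
  eqmod m f p -> eqmod m g q -> eqmod m (ps_mul f g) (p * q).
Proof.
move=> fp gq n ltnm; rewrite coefM; apply: eq_bigr => k _.
rewrite fp ?gq //; first exact: leq_ltn_trans (leq_subr _ _) ltnm.
by apply: leq_ltn_trans ltnm; rewrite -ltnS.
Qed.

Let eqmod_one m : eqmod m ps_one 1.
Proof. by move=> n _; rewrite coef1. Qed.

Let eqmod_one_mul m p q :
  eqmod m ps_one p -> eqmod m ps_one q -> eqmod m ps_one (p * q).
Proof.
move=> hp hq n ltnm; rewrite -(eqmod_mul hp hq ltnm) /ps_mul.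
rewrite big_ord_recl /= subn0 big1 ?addr0 => [|k _]; last by rewrite mul0r.
by rewrite mul1r.
Qed.

Let eqmod_geom m a : eqmod m (ps_geom a) (\poly_(i < m) a ^+ i).
Proof. by move=> n ltnm; rewrite coef_poly ltnm. Qed.

Let eqmod_geomK m a :
  eqmod m ps_one ((1 - a *: 'X) * \poly_(i < m) a ^+ i).
Proof.
move=> n ltnm; rewrite mulrBl mul1r -scalerAl coefB coefZ coefXM !coef_poly.
rewrite ltnm; case: n ltnm => [|n] ltnm /=; first by rewrite mulr0 subr0.
by rewrite (ltn_trans _ ltnm) // -exprS subrr.
Qed.

(* [gen_series x] is the inverse of prod_i (1 - x_i z) (1 - x_i^-1 z). *)
Lemma gen_seriesE N (x : 'I_N -> R) :
  let D : {poly R} :=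
    \prod_(i < N) ((1 - x i *: 'X) * (1 - (x i)^-1 *: 'X)) in
  ps_mul (fun k => D`_k) (gen_series x) =1 ps_one.
Proof.
move=> D n; pose G a : {poly R} := \poly_(i < n.+1) a ^+ i.
have hP : eqmod n.+1 (gen_series x) (\prod_(i < N) (G (x i) * G (x i)^-1)).
  rewrite /gen_series; apply: (big_rec2 (fun f p => eqmod n.+1 f p)).
    exact: eqmod_one.
  move=> i f p _ hfp; apply: eqmod_mul => //.
  by apply: eqmod_mul; apply: eqmod_geom.
have hD : eqmod n.+1 (fun k => D`_k) D by [].
rewrite (eqmod_mul hD hP) // /D -big_split /=; symmetry.
suff H : eqmod n.+1 ps_one (\prod_(i < N) ((1 - x i *: 'X) *
    (1 - (x i)^-1 *: 'X) * (G (x i) * G (x i)^-1))) by exact: H.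
apply: (big_ind (eqmod n.+1 ps_one)) => [|p q|i _].
- exact: eqmod_one.
- exact: eqmod_one_mul.
- by rewrite mulrACA; apply: eqmod_one_mul; apply: eqmod_geomK.
Qed.

End PowerSeries.

(* Parts are listed in weakly decreasing order and may vanish. *)
Definition is_partition N (lam : N.-tuple nat) : bool := sorted geq lam.

(* The default value of [nth] gives lambda_{N+1} = 0. *)
Definition interlace N (mu lam : N.-tuple nat) : bool :=
  [forall i : 'I_N, (nth 0 lam i.+1 <= nth 0 mu i <= nth 0 lam i)%N].

(* Turns tuples of bounded naturals, which form a finite type, into tuples of
   naturals. *)
Definition parts N b (mu : N.-tuple 'I_b) : N.-tuple nat :=
  map_tuple (@nat_of_ord b) mu.

(* The sums range over tuples with entries at most |lam|; no interlacing tuple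
   is lost, and none is counted twice. *)
Lemma interlace_bounded N (mu lam : N.-tuple nat) :
  interlace mu lam -> exists nu : N.-tuple 'I_(sumn lam).+1, parts nu = mu.
Proof.
move/forallP=> H; exists [tuple inord (tnth mu i) | i < N].
apply: eq_from_tnth => i; rewrite tnth_map tnth_mktuple inordK // ltnS.
have /andP[_ Hi] := H i; rewrite (tnth_nth 0) (leq_trans Hi) //.
by rewrite sumnE -(tnth_nth 0) big_tuple (bigD1 i) //= leq_addr.
Qed.

Lemma parts_inj N b : injective (@parts N b).
Proof.
move=> mu nu E; apply: eq_from_tnth => i; apply: val_inj.
by move/(congr1 (fun t => tnth t i)): E; rewrite !tnth_map.
Qed.

(* Row and column indices are ordinals starting at 0, hence [i.+1], [j.+1]. *)
Section Characters.
Variables (R : comUnitRingType) (N : nat) (x : 'I_N -> R).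
Variable lam : N.-tuple nat.

Definition so_char : R :=
  \det (\matrix_(i < N, j < N)
    (h x ((tnth lam i)%:Z - i.+1%:Z + j.+1%:Z) +
     h x ((tnth lam i)%:Z - i.+1%:Z - j.+1%:Z + 1))).

Definition sp_char : R :=
  \det (\matrix_(i < N, j < N)
    (h x ((tnth lam i)%:Z - i.+1%:Z + j.+1%:Z) +
     (1 < j.+1)%N%:R * h x ((tnth lam i)%:Z - i.+1%:Z - j.+1%:Z + 2))).

Definition o_char : R :=
  \det (\matrix_(i < N, j < N)
    (h x ((tnth lam i)%:Z - i.+1%:Z + j.+1%:Z) -
     h x ((tnth lam i)%:Z - i.+1%:Z - j.+1%:Z))).

End Characters.

(* Main.v *)
Require Import Defs.
From HB Require Import structures.
From mathcomp Require Import all_boot all_order all_algebra.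
From mathcomp Require Import zify ring.
Import GRing.Theory.
Local Open Scope ring_scope.

(** Summing a determinant over the interlacing [mu] amounts, by multilinearity,
    to summing each row over an interval.  If the rows are written as a
    (twisted) difference [U m - e * U (m - 1)], these sums telescope and row [i]
    becomes [U (lam_i - i)] minus a multiple of [U (lam_{i+1} - (i + 1))], so
    that the sum is the single determinant with rows [U (lam_i - i)].  Let
    the [j]-th entry of [U m] be [h_{m+j} + e * h_{m+j-1} + e^2 * h_{m+j-2} + ...]
    with [2 j] terms and [e = 1] (resp. [2 j - 1] terms and [e = -1]).  Then the
    twisted differences in [m] are the rows of [o] (resp. [so]), and those in [j]
    are the rows of [so] (resp. [sp]). *)

(** * Determinants of differences of consecutive rows or columns *)

Section Bidiagonal.
Variables (R : comNzRingType) (N : nat).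

Lemma det_bidiagonal (c : nat -> R) :
  \det (\matrix_(i < N, j < N) ((i == j)%:R - c i * (i.+1 == j :> nat)%:R)) = 1.
Proof.
rewrite -det_tr det_trig.
  by rewrite big1 // => i _; rewrite !mxE eqxx gtn_eqF // mulr0 subr0.
apply/is_trig_mxP => i j ltij; rewrite !mxE.
have -> : (j == i) = false by rewrite -val_eqE gtn_eqF.
by rewrite gtn_eqF ?mulr0 ?subr0 // (ltn_trans ltij).
Qed.

Lemma sum_ord_eq_nat (f : nat -> R) n :
  \sum_(k < N) (n == k :> nat)%:R * f k = if (n < N)%N then f n else 0.
Proof.
case: ltnP => [ltnN | leNn].
  rewrite (bigD1 (Ordinal ltnN)) //= eqxx mul1r big1 ?addr0 // => k neq.
  by rewrite eq_sym -[_ == _]/(k == Ordinal ltnN) (negPf neq) mul0r.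
by rewrite big1 // => k _; rewrite gtn_eqF ?mul0r // (leq_trans _ leNn).
Qed.

(** Left multiplication by an upper unitriangular bidiagonal matrix. The last row has no successor
    in the matrix, hence the condition on [f N]. *)
Lemma det_row_differences (c : nat -> R) (f : nat -> 'I_N -> R) :
  (forall j, f N j = 0) ->
  \det (\matrix_(i < N, j < N) (f i j - c i * f i.+1 j)) =
  \det (\matrix_(i < N, j < N) f i j).
Proof.
move=> fN; rewrite -[RHS]mul1r -(det_bidiagonal c) -det_mulmx; congr (\det _).
apply/matrixP => i j; rewrite !mxE.
under eq_bigr => k _ do rewrite !mxE mulrBl -mulrA.
rewrite sumrB -mulr_sumr (sum_ord_eq_nat (f^~ j)) (sum_ord_eq_nat (f^~ j)).
rewrite ltn_ord; congr (_ - _ * _); case: ltnP => // leN.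
by have -> : i.+1 = N by apply/eqP; rewrite eqn_leq leN ltn_ord.
Qed.

(** The analogue by right multiplication. Columns are shifted by one, so that index [0] is a virtual
    zero column to the left of the matrix. *)
Lemma det_col_differences (e : R) (f : 'I_N -> nat -> R) :
  (forall i, f i 0%N = 0) ->
  \det (\matrix_(i < N, j < N) (f i j.+1 - e * f i j)) =
  \det (\matrix_(i < N, j < N) f i j.+1).
Proof.
move=> f0; rewrite -[RHS]mulr1 -(det_bidiagonal (fun=> e)) -det_mulmx.
congr (\det _); apply/matrixP => i j; rewrite !mxE.
transitivity (\sum_(k < N) ((j == k :> nat)%:R * f i k.+1 -
                            e * ((j == k.+1 :> nat)%:R * f i k.+1))).
  rewrite sumrB -mulr_sumr (sum_ord_eq_nat (fun k => f i k.+1)) ltn_ord.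
  congr (_ - _ * _); case: j => -[|j] /= ltjN.
    by rewrite f0 big1 // => k _; rewrite mul0r.
  by rewrite (sum_ord_eq_nat (fun k => f i k.+1)) (ltnW ltjN).
apply: eq_bigr => k _; rewrite !mxE -val_eqE /= (eq_sym (j : nat)).
by rewrite (eq_sym (j : nat)); ring.
Qed.

End Bidiagonal.

(** * Sums over interlacing tuples as single determinants *)

Section Interlacing.
Variables (R : comNzRingType) (N : nat).

(** Multilinearity in the rows: in the Leibniz formula the product of sums expands over the choices
    of one [k] per row, and these choices are the tuples [mu]. *)
Lemma det_sum_rows b (Q : 'I_N -> pred 'I_b) (F : 'I_N -> 'I_b -> 'I_N -> R) :
  \det (\matrix_(i < N, j < N) \sum_(k | Q i k) F i k j) =
  \sum_(mu : N.-tuple 'I_b | [forall i, Q i (tnth mu i)])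
    \det (\matrix_(i < N, j < N) F i (tnth mu i) j).
Proof.
rewrite [LHS]/determinant.
under eq_bigr => s _.
  under eq_bigr => i _ do rewrite mxE.
  rewrite bigA_distr_big_dep /= big_distrr /=; over.
rewrite exchange_big /=.
rewrite (reindex (fun mu : N.-tuple 'I_b => [ffun i => tnth mu i])) /=; last first.
  exists (fun f : {ffun 'I_N -> 'I_b} => [tuple f i | i < N]) => [mu _ | f _].
    by apply: eq_from_tnth => i; rewrite tnth_mktuple ffunE.
  by apply/ffunP => i; rewrite ffunE tnth_mktuple.
apply: eq_big => [mu | mu _].
  by apply/familyP/forallP => H i; have := H i; rewrite ffunE.
apply: eq_bigr => s _; congr (_ * _).
by apply: eq_bigr => i _; rewrite mxE ffunE.
Qed.

Lemma twisted_telescope (e : R) (u : nat -> R) (a c b : nat) :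
  (a <= c < b)%N ->
  \sum_(k < b | (a <= k <= c)%N) e ^+ (c - k) * (u k.+1 - e * u k) =
  u c.+1 - e ^+ (c.+1 - a) * u a.
Proof.
case/andP=> leac ltcb.
transitivity (\sum_(a <= k < c.+1) e ^+ (c - k) * (u k.+1 - e * u k)).
  rewrite (big_nat_widen _ _ _ _ _ ltcb) big_geq_mkord.
  by apply: eq_bigl => k; rewrite /= ltnS andbC.
(* The weight absorbs the twist: each summand is a plain difference of consecutive values of this
   function. *)
rewrite (telescope_sumr_eq (fun k => e ^+ (c.+1 - k) * u k)) ?leqW //.
  by rewrite subnn expr0 mul1r.
move=> k /andP[_]; rewrite ltnS subSS => lekc.
by rewrite subSn // exprS; ring.
Qed.

Lemma is_partition_nth (lam : N.-tuple nat) (i : nat) :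
  is_partition lam -> (nth 0 lam i.+1 <= nth 0 lam i)%N.
Proof.
move=> hlam; case: (ltnP i.+1 (size lam)) => [lti | ?]; last by rewrite nth_default.
by apply: (sortedP 0 hlam).
Qed.

Lemma sum_interlace_det (lam : N.-tuple nat) (e : R) (U : int -> 'I_N -> R) :
  is_partition lam -> (forall j, U (- N.+1%:Z) j = 0) ->
  \sum_(mu : N.-tuple 'I_(sumn lam).+1 | interlace (parts mu) lam)
    e ^+ (sumn lam - sumn (parts mu)) *
    \det (\matrix_(i < N, j < N)
      (U ((tnth (parts mu) i)%:Z - i.+1%:Z) j -
       e * U ((tnth (parts mu) i)%:Z - i.+1%:Z - 1) j)) =
  \det (\matrix_(i < N, j < N) U ((tnth lam i)%:Z - i.+1%:Z) j).
Proof.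
move=> hlam U0; set b := (sumn lam).+1.
pose f (i : nat) (j : 'I_N) := U ((nth 0 lam i)%:Z - i.+1%:Z) j.
(* The exponent is the number of admissible values of [mu_i], hence of terms telescoped in row
   [i]. *)
pose c (i : nat) := e ^+ ((nth 0 lam i).+1 - nth 0 lam i.+1).
have tnthE (mu : N.-tuple nat) (i : 'I_N) : tnth mu i = nth 0 mu i by exact: tnth_nth.
have -> : \matrix_(i < N, j < N) U ((tnth lam i)%:Z - i.+1%:Z) j =
          \matrix_(i < N, j < N) f i j.
  by apply/matrixP => i j; rewrite !mxE tnthE.
rewrite -(det_row_differences _ _ c); last first.
  (* Row [N] reads the default part [0], so [U] is evaluated at [- N.+1]. *)
  by move=> j; rewrite /f nth_default ?size_tuple // sub0r U0.
pose F (i : 'I_N) (k : 'I_b) (j : 'I_N) : R :=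
  e ^+ (nth 0 lam i - k) * (U (k%:Z - i.+1%:Z) j - e * U (k%:Z - i.+1%:Z - 1) j).
pose Q (i : 'I_N) := [pred k : 'I_b | (nth 0 lam i.+1 <= k <= nth 0 lam i)%N].
transitivity (\det (\matrix_(i < N, j < N) \sum_(k | Q i k) F i k j)); last first.
  congr (\det _); apply/matrixP => i j; rewrite !mxE.
  have lt_lam_b : (nth 0 lam i < b)%N.
    by rewrite ltnS -tnthE sumnE big_tuple (bigD1 i) //= leq_addr.
  have bnd : (nth 0 lam i.+1 <= nth 0 lam i < b)%N by rewrite is_partition_nth.
  have succE (k : nat) : k.+1%:Z - i.+1%:Z - 1 = k%:Z - i.+1%:Z by lia.
  (* At [k = nth 0 lam i.+1] this turns the lower boundary term of row [i] into row [i.+1] of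
     [f]. *)
  have predE (k : nat) : k%:Z - i.+1%:Z - 1 = k%:Z - i.+2%:Z by lia.
  have := twisted_telescope e (fun k => U (k%:Z - i.+1%:Z - 1) j) _ _ _ bnd.
  rewrite succE predE => <-; apply: eq_bigr => k _.
  by rewrite /F succE.
rewrite det_sum_rows; apply: eq_big => [mu | mu Hmu].
  by rewrite /interlace; apply: eq_forallb => i; rewrite /Q /= -tnthE tnth_map.
have -> : e ^+ (sumn lam - sumn (parts mu)) =
          \prod_(i < N) e ^+ (nth 0 lam i - tnth mu i).
  rewrite -expr_sum !sumnE !big_tuple -sumnB => [|i _]; last first.
    by have /andP[_] := forallP Hmu i; rewrite !tnthE.
  by congr (e ^+ _); apply: eq_bigr => i _; rewrite tnthE tnth_map.
rewrite /determinant big_distrr /=; apply: eq_bigr => s _.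
rewrite mulrCA -big_split /=; congr (_ * _); apply: eq_bigr => i _.
by rewrite !mxE /F tnth_map.
Qed.

End Interlacing.

(** * Truncated twisted sums of the [h_n] *)

Section TruncatedSeries.
Variables (R : comNzRingType) (N : nat) (h : int -> R) (e : R).
Hypothesis h_neg : forall n : nat, h (Negz n) = 0.

(** Formally the coefficient of [z^m] in [H(z) (1 - (e z)^n) / (1 - e z)], where [H] is the
    generating series of [h]. *)
Definition twisted_sum n (m : int) : R := \sum_(l < n) e ^+ l * h (m - l%:Z).

Lemma twisted_sumS n m :
  twisted_sum n.+1 m = h m + e * twisted_sum n (m - 1).
Proof.
rewrite /twisted_sum big_ord_recl /= expr0 mul1r subr0 big_distrr /=.
congr (_ + _); apply: eq_bigr => l _.
by rewrite exprS mulrA; congr (_ * h _); rewrite /bump /=; lia.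
Qed.

Lemma twisted_sum_rcons n m :
  twisted_sum n.+1 m = twisted_sum n m + e ^+ n * h (m - n%:Z).
Proof. by rewrite /twisted_sum big_ord_recr. Qed.

Lemma twisted_sum_pred n m :
  twisted_sum n m - e * twisted_sum n (m - 1) = h m - e ^+ n * h (m - n%:Z).
Proof.
by have := twisted_sumS n m; rewrite twisted_sum_rcons => /(canRL (addrK _)) ->; ring.
Qed.

(** The subtracted sum cancels all but the two end terms. This is the step between adjacent columns:
    the argument grows by one, the length by two. *)
Lemma twisted_sum_succ n m :
  twisted_sum n.+2 m - e * twisted_sum n (m - 1) =
  h m + e ^+ n.+1 * h (m - n.+1%:Z).
Proof.
rewrite twisted_sumS twisted_sum_rcons exprS.
have -> : m - 1 - n%:Z = m - n.+1%:Z by lia.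
ring.
Qed.

Lemma twisted_sum_neg n m : m < 0 -> twisted_sum n m = 0.
Proof.
move=> m0; rewrite /twisted_sum big1 // => l _.
have -> : m - l%:Z = Negz (`|m| + l).-1 by lia.
by rewrite h_neg mulr0.
Qed.

Lemma det_twisted_sum (a : 'I_N -> int) (len : nat -> nat) :
  len 0%N = 0%N ->
  \det (\matrix_(i < N, j < N) twisted_sum (len j.+1) (a i + j.+1%:Z)) =
  \det (\matrix_(i < N, j < N)
    (twisted_sum (len j.+1) (a i + j.+1%:Z) -
     e * twisted_sum (len j) (a i + j%:Z))).
Proof.
move=> len0; symmetry.
apply: (det_col_differences _ _ e (fun i j => twisted_sum (len j) (a i + j%:Z))).
by move=> i; rewrite len0 /twisted_sum big_ord0.
Qed.

End TruncatedSeries.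

Arguments twisted_sum {R} h e n m.

Theorem theorem4p2 (R : comUnitRingType) (N : nat) (x : 'I_N -> R)
    (lam : N.-tuple nat) (hN : (1 <= N)%N)
    (hx : forall i : 'I_N, x i \is a GRing.unit)
    (hlam : is_partition lam) :
  sp_char x lam =
    \sum_(mu : N.-tuple 'I_(sumn lam).+1 | interlace (parts mu) lam)
      (-1) ^+ (sumn lam - sumn (parts mu)) * so_char x (parts mu)
  /\
  so_char x lam =
    \sum_(mu : N.-tuple 'I_(sumn lam).+1 | interlace (parts mu) lam)
      o_char x (parts mu).
Proof.
(* The argument is [j - N < 0], which gives the boundary condition of [sum_interlace_det]. *)
have U0 e len (j : 'I_N) :
    twisted_sum (h x) e (len j.+1) (- N.+1%:Z + j.+1%:Z) = 0.
  by rewrite twisted_sum_neg //; have := ltn_ord j; lia.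
split.
(* Truncated subtraction gives [len 0 = 0], the empty sum required to the left of the first
   column. *)
- pose len j := (j.*2.-1)%N.
  have := sum_interlace_det _ _ lam (-1)
    (fun m j => twisted_sum (h x) (-1) (len j.+1) (m + j.+1%:Z)) hlam (U0 _ len).
  rewrite (det_twisted_sum _ _ _ _ _ len) // => E; transitivity (\det (\matrix_(i < N, j < N)
     (twisted_sum (h x) (-1) (len j.+1) ((tnth lam i)%:Z - i.+1%:Z + j.+1%:Z) -
      -1 * twisted_sum (h x) (-1) (len j) ((tnth lam i)%:Z - i.+1%:Z + j%:Z)))).
    congr (\det _); apply/matrixP => i [[|j] ltj]; rewrite !mxE /=.
      (* In the first column the length grows only from [0] to [1], leaving a single [h]: this is
         the factor [1 < j.+1] in [sp_char]. *)
      by rewrite /len /= /twisted_sum big_ord0 big_ord1 expr0 subr0; ring.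
    set m := (tnth lam i)%:Z - i.+1%:Z.
    have -> : m + j.+1%:Z = m + j.+2%:Z - 1 by lia.
    rewrite /len !doubleS /= twisted_sum_succ -signr_odd /= odd_double !mul1r.
    by congr (_ + h x _); lia.
  rewrite -E; apply: eq_bigr => mu _; congr (_ * \det _).
  apply/matrixP => i j; rewrite !mxE.
  set m := _ - i.+1%:Z.
  have -> : m - 1 + j.+1%:Z = m + j.+1%:Z - 1 by lia.
  (* The length is odd, so [- (-1) ^+ n = 1] yields the plus sign of [so_char]. *)
  rewrite twisted_sum_pred /len doubleS /= exprS -signr_odd odd_double.
  rewrite expr0 mulr1 mulN1r opprK; congr (_ + h x _); lia.
(* Lengths [j.*2] grow by two already from [j = 0], so no column is exceptional. *)
- have := sum_interlace_det _ _ lam 1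
    (fun m j => twisted_sum (h x) 1 (j.+1.*2) (m + j.+1%:Z)) hlam (U0 _ double).
  rewrite (det_twisted_sum _ _ _ _ _ double) // => E.
  transitivity (\det (\matrix_(i < N, j < N)
     (twisted_sum (h x) 1 j.+1.*2 ((tnth lam i)%:Z - i.+1%:Z + j.+1%:Z) -
      1 * twisted_sum (h x) 1 j.*2 ((tnth lam i)%:Z - i.+1%:Z + j%:Z)))).
    congr (\det _); apply/matrixP => i j; rewrite !mxE.
    set m := (tnth lam i)%:Z - i.+1%:Z.
    have -> : m + j%:Z = m + j.+1%:Z - 1 by lia.
    rewrite doubleS twisted_sum_succ expr1n mul1r.
    by congr (_ + h x _); lia.
  rewrite -E; apply: eq_bigr => mu _; rewrite expr1n mul1r; congr (\det _).
  apply/matrixP => i j; rewrite !mxE.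
  set m := _ - i.+1%:Z.
  have -> : m - 1 + j.+1%:Z = m + j.+1%:Z - 1 by lia.
  by rewrite twisted_sum_pred expr1n mul1r; congr (_ - h x _); lia.
Qed.
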